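(* Let $D_1,D_2,D_3$ be three smooth strictly convex outer billiard tables and $T_1,T_2,T_3$ the respective outer billiard maps. Then the set of fixed points of $T_3\circ T_2\circ T_1$ has empty interior.
   Context: An outer billiard table is a strictly convex compact plane domain $D$ (here with smooth boundary). The outer billiard map $T$ is defined on the exterior of $D$: for $x$ outside $D$, take the right support line from $x$ to $D$ (from $x$'s viewpoint) and reflect $x$ in the support point to obtain $T(x)$. *)

(* Defs.v *)
From Stdlib Require Import Reals.
From Coquelicot Require Import Coquelicot.
Open Scope R_scope.

Definition pt := (R * R)%type.

Definition padd (p q : pt) : pt := (fst p + fst q, snd p + snd q).
Definition psub (p q : pt) : pt := (fst p - fst q, snd p - snd q).
Definition pscal (t : R) (p : pt) : pt := (t * fst p, t * snd p).

Definition cross (u v : pt) : R := fst u * snd v - snd u * fst v.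

Definition pdist (p q : pt) : R :=
  sqrt ((fst p - fst q) ^ 2 + (snd p - snd q) ^ 2).
Definition in_ball (c : pt) (r : R) (x : pt) : Prop := pdist c x < r.

Definition pinterior (D : pt -> Prop) (x : pt) : Prop :=
  exists r, 0 < r /\ forall y, in_ball x r y -> D y.

Definition p_open (U : pt -> Prop) : Prop := forall x, U x -> pinterior U x.
Definition p_closed (D : pt -> Prop) : Prop := p_open (fun x => ~ D x).
Definition is_bounded (D : pt -> Prop) : Prop :=
  exists M, forall x, D x -> pdist (0, 0) x <= M.
Definition is_compact (D : pt -> Prop) : Prop := p_closed D /\ is_bounded D.

(* topological pboundary of a closed set *)
Definition pboundary (D : pt -> Prop) (x : pt) : Prop := D x /\ ~ pinterior D x.

Definition strictly_convex (D : pt -> Prop) : Prop :=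
  forall p q t, D p -> D q -> p <> q -> 0 < t < 1 ->
    pinterior D (padd p (pscal t (psub q p))).

Definition pconvex (D : pt -> Prop) : Prop :=
  forall p q t, D p -> D q -> 0 <= t <= 1 -> D (padd p (pscal t (psub q p))).

Definition smooth_fun (f : R -> R) : Prop := forall n t, ex_derive_n f n t.

Definition smooth_boundary (D : pt -> Prop) : Prop :=
  exists (g : R -> pt) (L : R),
    0 < L /\
    smooth_fun (fun t => fst (g t)) /\ smooth_fun (fun t => snd (g t)) /\
    (forall t, g (t + L) = g t) /\
    (forall s t, 0 <= s < L -> 0 <= t < L -> g s = g t -> s = t) /\
    (forall t, Derive (fun u => fst (g u)) t <> 0 \/
               Derive (fun u => snd (g u)) t <> 0) /\
    (forall x, pboundary D x <-> exists t, g t = x).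

Definition outer_billiard_table (D : pt -> Prop) : Prop :=
  is_compact D /\ pconvex D /\ strictly_convex D /\ (exists x, pinterior D x) /\
  smooth_boundary D.

(* Graph of the outer billiard map T of D: for x outside D, p is the support
   point of the right support line from x (D lies to the left of the oriented
   line from x through p), and T x = 2 p - x = p + (p - x).
   For a strictly convex domain p is unique, so this relation is the graph of
   the (partial) map T defined on the exterior of D. *)
Definition outer_billiard (D : pt -> Prop) (x y : pt) : Prop :=
  ~ D x /\
  exists p, D p /\ (forall q, D q -> 0 <= cross (psub p x) (psub q x)) /\
            y = padd p (psub p x).

(* Main.v *)
Require Import Defs.
From Stdlib Require Import Reals Lra Lia Psatz Classical IndefiniteDescription.
From Coquelicot Require Import Coquelicot.
Open Scope R_scope.

(** Let [z], [y1], [y2] be a triangle whose sides touch [D1], [D2], [D3] at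
    their midpoints [p1], [p2], [p3]. Sliding [z] along its support line to
    [D1] keeps [p1] fixed. The support inequalities of [D2] and [D3], compared
    at two positions of [z], show that the area of the triangle is constant and
    that [y2] moves on a fixed line through [p1], both up to an error quadratic
    in the displacement, hence exactly. So [p2] describes an arc of a hyperbola
    centred at [p1], and by continuity of the support point this arc fills a
    neighbourhood of [p2] in the boundary of [D2]. A nearby [z] off the line has
    another contact point with [D1], since [D1] has only one tangent at [p1].
    The two hyperbolas then share an arc but have different centres. *)

Ltac pt_simpl := unfold padd, psub, pscal, cross in *; simpl in *.

(** * Square neighbourhoods *)

(** Sup-norm balls allow coordinatewise estimates without square roots. *)
Definition near (d : R) (x y : pt) : Prop :=
  Rabs (fst y - fst x) < d /\ Rabs (snd y - snd x) < d.

Lemma near_in_ball (r : R) (x y : pt) : near (r / 2) x y -> in_ball x r y.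
Proof.
  destruct x as [x1 x2], y as [y1 y2]; unfold near, in_ball, pdist; simpl fst; simpl snd.
  intros [H1 H2]; apply Rabs_def2 in H1; apply Rabs_def2 in H2.
  assert (0 < r) by lra.
  rewrite <- (sqrt_pow2 r) by lra.
  pose proof (pow2_ge_0 (x1 - y1)); pose proof (pow2_ge_0 (x2 - y2)).
  apply sqrt_lt_1_alt; split; [lra|].
  assert ((x1 - y1) ^ 2 <= (r / 2) ^ 2) by nra.
  assert ((x2 - y2) ^ 2 <= (r / 2) ^ 2) by nra.
  nra.
Qed.

Lemma interior_near (D : pt -> Prop) (x : pt) :
  pinterior D x -> exists d, 0 < d /\ forall y, near d x y -> D y.
Proof.
  intros [r [Hr H]]; exists (r / 2); split; [lra|].
  intros y Hy; apply H, near_in_ball, Hy.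
Qed.

Lemma near_open (d : R) (x y : pt) :
  near d x y -> exists e, 0 < e /\ forall z, near e y z -> near d x z.
Proof.
  destruct x as [x1 x2], y as [y1 y2]; unfold near; simpl; intros [H1 H2].
  exists (Rmin (d - Rabs (y1 - x1)) (d - Rabs (y2 - x2))); split.
  - apply Rmin_pos; lra.
  - intros [z1 z2]; simpl; intros [G1 G2].
    pose proof (Rmin_l (d - Rabs (y1 - x1)) (d - Rabs (y2 - x2))).
    pose proof (Rmin_r (d - Rabs (y1 - x1)) (d - Rabs (y2 - x2))).
    split.
    + replace (z1 - x1) with ((z1 - y1) + (y1 - x1)) by ring.
      eapply Rle_lt_trans; [apply Rabs_triang|lra].
    + replace (z2 - x2) with ((z2 - y2) + (y2 - x2)) by ring.
      eapply Rle_lt_trans; [apply Rabs_triang|lra].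
Qed.

Lemma pos_norm1 (a b : R) : (a, b) <> (0, 0) -> 0 < Rabs a + Rabs b.
Proof.
  intros H; destruct (Req_dec a 0) as [->|Ha].
  - destruct (Req_dec b 0) as [->|Hb]; [now contradict H|].
    apply Rabs_pos_lt in Hb; pose proof (Rabs_pos 0); lra.
  - apply Rabs_pos_lt in Ha; pose proof (Rabs_pos b); lra.
Qed.

Lemma pos_norm2 (a b : R) : (a, b) <> (0, 0) -> 0 < a * a + b * b.
Proof.
  intros H; destruct (Req_dec a 0) as [->|Ha].
  - destruct (Req_dec b 0) as [->|Hb]; [now contradict H|nra].
  - nra.
Qed.

Lemma psub_neq0 (p q : pt) : p <> q -> psub p q <> (0, 0).
Proof.
  intros H E; apply H; destruct p, q; pt_simpl; injection E; intros.
  f_equal; lra.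
Qed.

(** * Support lines and contact points *)

(** A small step from [x] along the clockwise normal [(u2, - u1)] makes the cross product
    negative. *)
Lemma interior_not_supported (D : pt -> Prop) (u x : pt) :
  pinterior D x -> u <> (0, 0) -> exists y, D y /\ cross u (psub y x) < 0.
Proof.
  intros Hi Hu; apply interior_near in Hi as [d [Hd Hi]].
  destruct u as [u1 u2], x as [x1 x2].
  pose proof (pos_norm1 _ _ Hu) as N1; pose proof (pos_norm2 _ _ Hu) as N2.
  set (m := Rabs u1 + Rabs u2) in *.
  set (s := d / (2 * m)).
  assert (Hs0 : 0 < s) by (apply Rdiv_lt_0_compat; lra).
  assert (Hsm : s * m = d / 2) by (unfold s; field; lra).
  assert (Rabs u1 <= m /\ Rabs u2 <= m) as [M1 M2].
  { unfold m; pose proof (Rabs_pos u1); pose proof (Rabs_pos u2); lra. }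
  exists (x1 + s * u2, x2 - s * u1); split.
  - apply Hi; unfold near; simpl; split;
      [ replace (_ - _) with (s * u2) by ring | replace (_ - _) with (s * - u1) by ring ];
      rewrite Rabs_mult, (Rabs_pos_eq s) by lra; rewrite ?Rabs_Ropp; nra.
  - pt_simpl; nra.
Qed.

(** Otherwise the midpoint of [p] and [q] would be an interior point on the line, and [D] would
    reach its negative side. *)
Lemma support_line_unique (D : pt -> Prop) (u x p q : pt) :
  strictly_convex D -> u <> (0, 0) ->
  (forall s, D s -> 0 <= cross u (psub s x)) ->
  D p -> D q -> cross u (psub p x) = 0 -> cross u (psub q x) = 0 -> p = q.
Proof.
  intros SC Hu Hs Hp Hq Ep Eq; apply NNPP; intros Hpq.
  assert (Hi := SC p q (1/2) Hp Hq Hpq ltac:(lra)).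
  destruct (interior_not_supported _ u _ Hi Hu) as [y [Dy Hy]].
  specialize (Hs _ Dy); pt_simpl; lra.
Qed.

Definition support_point (D : pt -> Prop) (x p : pt) : Prop :=
  ~ D x /\ D p /\ forall q, D q -> 0 <= cross (psub p x) (psub q x).

Lemma support_point_dir (D : pt -> Prop) (x p : pt) :
  support_point D x p -> psub p x <> (0, 0).
Proof. intros [Hx [Hp _]]; apply psub_neq0; congruence. Qed.

(** Testing each contact inequality on the other point gives a cross product of both signs, so [p]
    and [q] lie on one support line. *)
Lemma support_point_unique (D : pt -> Prop) (x p q : pt) :
  strictly_convex D -> support_point D x p -> support_point D x q -> p = q.
Proof.
  intros SC Hp Hq.
  apply (support_line_unique D (psub p x) x); trivial.
  - now apply support_point_dir with D.
  - apply Hp.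
  - apply Hp.
  - apply Hq.
  - unfold cross; ring.
  - destruct Hp as [_ [Dp Hp]], Hq as [_ [Dq Hq]].
    specialize (Hp _ Dq); specialize (Hq _ Dp); unfold cross in *; lra.
Qed.

(** * Continuity of the contact point *)

Lemma closed_avoid (D : pt -> Prop) (a : pt) :
  p_closed D -> ~ D a -> exists d, 0 < d /\ forall y, near d a y -> ~ D y.
Proof. intros HC Ha; exact (interior_near _ _ (HC a Ha)). Qed.

Lemma bounded_coord (D : pt -> Prop) :
  is_bounded D ->
  exists M, 0 < M /\ forall p, D p -> Rabs (fst p) <= M /\ Rabs (snd p) <= M.
Proof.
  intros [M H]; exists (Rmax M 1); split.
  - eapply Rlt_le_trans; [apply Rlt_0_1|apply Rmax_r].
  - intros [a b] Hp; specialize (H _ Hp); unfold pdist in H; simpl fst in *; simpl snd in *.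
    pose proof (Rmax_l M 1).
    pose proof (pow2_ge_0 (0 - a)); pose proof (pow2_ge_0 (0 - b)).
    assert (Hsq : 0 <= (0 - a) ^ 2 + (0 - b) ^ 2) by lra.
    pose proof (sqrt_pos ((0 - a) ^ 2 + (0 - b) ^ 2)) as S1.
    pose proof (sqrt_sqrt _ Hsq) as S2.
    assert (E : (0 - a) ^ 2 + (0 - b) ^ 2 <= M * M) by nra.
    assert (a * a <= M * M /\ b * b <= M * M) as [A B] by nra.
    assert (0 <= M) by lra.
    split; apply Rle_trans with M; trivial; apply Rabs_le; nra.
Qed.

(* A point of D close to the support line but far from p0 would give, by
   convexity, a point of D close to one of the two points of the line at a
   fixed distance from p0; these are not in the closed set D. *)
Lemma support_line_stable (D : pt -> Prop) (x0 p0 : pt) :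
  p_closed D -> pconvex D -> strictly_convex D -> support_point D x0 p0 ->
  forall e, 0 < e -> exists h, 0 < h /\
    forall q, D q -> cross (psub p0 x0) (psub q x0) < h -> near e p0 q.
Proof.
  intros HC HV SC HS e He.
  pose proof (support_point_dir _ _ _ HS) as Hu.
  destruct x0 as [x1 x2], p0 as [p1 p2].
  set (u1 := p1 - x1); set (u2 := p2 - x2).
  assert (Hu' : (u1, u2) <> (0, 0)) by exact Hu.
  pose proof (pos_norm1 _ _ Hu') as N1; pose proof (pos_norm2 _ _ Hu') as N2.
  set (m := Rabs u1 + Rabs u2) in *; set (n := u1 * u1 + u2 * u2) in *.
  assert (Rabs u1 <= m /\ Rabs u2 <= m) as [M1 M2].
  { unfold m; pose proof (Rabs_pos u1); pose proof (Rabs_pos u2); lra. }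
  (* With this [f] the points [p0 + f u] and [p0 - f u] of the support line are within [e / 2] of
     [p0]. *)
  set (f := e / (2 * m)).
  assert (Hf : 0 < f) by (apply Rdiv_lt_0_compat; lra).
  assert (Hfm : f * m = e / 2) by (unfold f; field; lra).
  assert (Out : forall s, s <> 0 -> ~ D (p1 + s * u1, p2 + s * u2)).
  { intros s Hs HD; pose proof (proj2 (proj2 HS)) as HS3.
    assert (E := support_line_unique D _ (x1, x2) (p1, p2) _ SC Hu HS3 (proj1 (proj2 HS)) HD).
    unfold cross, psub in E; simpl in E; fold u1 u2 in E.
    assert (E' := E ltac:(ring) ltac:(unfold u1, u2; ring)).
    injection E'; intros E2 E1; apply Hu'.
    assert (s * u1 = 0) by lra; assert (s * u2 = 0) by lra.
    f_equal; nra. }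
  destruct (closed_avoid D _ HC (Out f ltac:(lra))) as [r1 [Hr1 A1]].
  destruct (closed_avoid D _ HC (Out (- f) ltac:(lra))) as [r2 [Hr2 A2]].
  set (r := Rmin (Rmin r1 r2) (e / 2)).
  assert (Hr : 0 < r) by (unfold r; repeat apply Rmin_pos; lra).
  assert (r <= r1 /\ r <= r2 /\ r <= e / 2) as [L1 [L2 L3]].
  { unfold r; pose proof (Rmin_l (Rmin r1 r2) (e / 2)); pose proof (Rmin_r (Rmin r1 r2) (e / 2)).
    pose proof (Rmin_l r1 r2); pose proof (Rmin_r r1 r2); lra. }
  exists (r * n / m); split; [apply Rdiv_lt_0_compat; nra|].
  intros [q1 q2] HD Hq.
  pose proof (proj2 (proj2 HS) _ HD) as Hq0.
  unfold cross, psub in Hq, Hq0; simpl in Hq, Hq0; fold u1 u2 in Hq, Hq0.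
  (* Tangential and normal coordinates: [q - p0] is [al] times [u] plus [be] times the quarter turn
     of [u]. *)
  set (al := (u1 * (q1 - p1) + u2 * (q2 - p2)) / n).
  set (be := (u1 * (q2 - x2) - u2 * (q1 - x1)) / n).
  assert (E1 : q1 = p1 + al * u1 - be * u2).
  { unfold al, be, n, u1, u2 in *; field; unfold n in N2; lra. }
  assert (E2 : q2 = p2 + al * u2 + be * u1).
  { unfold al, be, n, u1, u2 in *; field; unfold n in N2; lra. }
  assert (B0 : 0 <= be) by (apply Rdiv_le_0_compat; lra).
  assert (B1 : be * m < r).
  { replace r with ((r * n / m) * m / n) by (field; lra).
    unfold be, Rdiv. rewrite (Rmult_comm _ (/ n)), Rmult_assoc.
    rewrite (Rmult_comm _ (/ n)). apply Rmult_lt_compat_l; [now apply Rinv_0_lt_compat|].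
    apply Rmult_lt_compat_r; lra. }
  assert (Small : forall t, 0 <= t <= 1 -> Rabs (t * be * u1) < r /\ Rabs (t * be * u2) < r).
  { intros t Ht; rewrite !Rabs_mult, (Rabs_pos_eq t), (Rabs_pos_eq be) by lra.
    pose proof (Rabs_pos u1); pose proof (Rabs_pos u2).
    assert (G : forall c, 0 <= c <= m -> t * be * c < r).
    { intros c Hc. assert (be * c <= be * m) by (apply Rmult_le_compat_l; lra).
      assert (0 <= be * c) by (apply Rmult_le_pos; lra).
      rewrite Rmult_assoc. assert (t * (be * c) <= 1 * (be * c)) by (apply Rmult_le_compat_r; lra).
      lra. }
    split; apply G; lra. }
  assert (Hal : Rabs al < f).
  { apply Rnot_le_lt; intros Hle.
    assert (P : 0 < Rabs al) by lra.
    (* Shrinking the segment from [p0] to [q] by [t] brings the tangential coordinate to [f] or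
       [- f], next to one of the two excluded points. *)
    set (t := f / Rabs al).
    assert (Ht : 0 <= t <= 1).
    { unfold t; split; [apply Rdiv_le_0_compat; lra|].
      apply Rmult_le_reg_r with (Rabs al); trivial. field_simplify; lra. }
    assert (Hc := HV _ _ t (proj1 (proj2 HS)) HD Ht).
    destruct (Small t Ht) as [S1 S2].
    unfold padd, pscal, psub in Hc; simpl in Hc.
    destruct (Rle_dec 0 al) as [Hp|Hn].
    - assert (Et : t * al = f) by (unfold t; rewrite Rabs_pos_eq by lra; field; rewrite Rabs_pos_eq in P; lra).
      apply (A1 _ ) in Hc; [exact Hc|]; unfold near; simpl; split.
      + replace (_ - _) with (- (t * be * u2)) by (rewrite E1; nra). rewrite Rabs_Ropp; lra.
      + replace (_ - _) with (t * be * u1) by (rewrite E2; nra). lra.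
    - assert (Et : t * al = - f) by (unfold t; rewrite Rabs_left by lra; field; lra).
      apply (A2 _ ) in Hc; [exact Hc|]; unfold near; simpl; split.
      + replace (_ - _) with (- (t * be * u2)) by (rewrite E1; nra). rewrite Rabs_Ropp; lra.
      + replace (_ - _) with (t * be * u1) by (rewrite E2; nra). lra. }
  destruct (Small 1 ltac:(lra)) as [S1 S2].
  pose proof (Rabs_pos al); pose proof (Rabs_pos u1); pose proof (Rabs_pos u2).
  assert (Rabs al * Rabs u1 <= f * m) by nra.
  assert (Rabs al * Rabs u2 <= f * m) by nra.
  unfold near; simpl; split.
  - replace (q1 - p1) with (al * u1 + - (1 * be * u2)) by (rewrite E1; ring).
    eapply Rle_lt_trans; [apply Rabs_triang|]. rewrite Rabs_Ropp, (Rabs_mult al u1); lra.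
  - replace (q2 - p2) with (al * u2 + 1 * be * u1) by (rewrite E2; ring).
    eapply Rle_lt_trans; [apply Rabs_triang|]. rewrite (Rabs_mult al u2); lra.
Qed.

(** The contact inequality at [x], tested on [p0], bounds [cross (p0 - x0) (p - x0)] by a multiple
    of the displacement of [x], since [D] is bounded. Hence [p] is close to the support line at
    [x0], and [support_line_stable] applies. *)
Lemma support_point_continuous (D : pt -> Prop) (x0 p0 : pt) :
  is_compact D -> pconvex D -> strictly_convex D -> support_point D x0 p0 ->
  forall e, 0 < e -> exists d, 0 < d /\
    forall x p, near d x0 x -> support_point D x p -> near e p0 p.
Proof.
  intros [HC HB] HV SC HS e He.
  destruct (support_line_stable D x0 p0 HC HV SC HS e He) as [h [Hh Hq]].
  destruct (bounded_coord D HB) as [M [HM Hbd]].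
  destruct x0 as [x1 x2], p0 as [p1 p2].
  set (C := 2 * M + Rabs x1 + Rabs x2 + Rabs (p1 - x1) + Rabs (p2 - x2)).
  pose proof (Rabs_pos x1); pose proof (Rabs_pos x2).
  pose proof (Rabs_pos (p1 - x1)); pose proof (Rabs_pos (p2 - x2)).
  assert (HC0 : 0 < C) by (unfold C; lra).
  exists (h / (2 * C)); split; [apply Rdiv_lt_0_compat; lra|].
  intros [y1 y2] [q1 q2] [Hn1 Hn2] Hsp; simpl in Hn1, Hn2.
  apply Hq; [apply Hsp|].
  destruct (Hbd _ (proj1 (proj2 Hsp))) as [B1 B2]; simpl in B1, B2.
  pose proof (proj2 (proj2 Hsp) _ (proj1 (proj2 HS))) as K.
  set (d := h / (2 * C)) in *.
  assert (Ed : C * d = h / 2) by (unfold d; field; lra).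
  assert (Hd : 0 < d) by (apply Rdiv_lt_0_compat; lra).
  unfold cross, psub in *; simpl in *.
  assert (T : forall a b A, Rabs a <= A -> Rabs b < d -> a * b <= A * d).
  { intros a b A Ha Hb; eapply Rle_trans; [apply Rle_abs|].
    rewrite Rabs_mult; pose proof (Rabs_pos a); pose proof (Rabs_pos b); nra. }
  assert (X1 : Rabs (- (q1 - x1)) <= M + Rabs x1).
  { rewrite Rabs_Ropp; unfold Rminus; eapply Rle_trans; [apply Rabs_triang|rewrite Rabs_Ropp; lra]. }
  assert (X2 : Rabs (q2 - x2) <= M + Rabs x2).
  { unfold Rminus; eapply Rle_trans; [apply Rabs_triang|rewrite Rabs_Ropp; lra]. }
  assert (X3 : Rabs (- (p2 - x2)) <= Rabs (p2 - x2)) by (rewrite Rabs_Ropp; lra).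
  pose proof (T _ _ _ X1 Hn2) as T1.
  pose proof (T _ _ _ X2 Hn1) as T2.
  pose proof (T _ _ _ X3 Hn1) as T3.
  pose proof (T _ _ _ (Rle_refl (Rabs (p1 - x1))) Hn2) as T4.
  assert (C * d = (M + Rabs x1) * d + (M + Rabs x2) * d + Rabs (p2 - x2) * d + Rabs (p1 - x1) * d)
    by (unfold C; ring).
  nra.
Qed.

(** * Tangents of a smooth boundary *)

Lemma derive_at_min (f : R -> R) (t : R) :
  ex_derive f t -> (forall s, f t <= f s) -> Derive f t = 0.
Proof.
  intros Hd Hm.
  assert (pr : derivable_pt f t) by (apply ex_derive_Reals_0; exact Hd).
  rewrite <- (Derive_Reals f t pr).
  apply (deriv_minimum f (t - 1) (t + 1)); intros; auto; lra.
Qed.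

(** Along the boundary curve the linear forms given by [u] and [v] are both minimal at [p]. Their
    derivatives vanish there, so both vectors are parallel to the nonzero velocity. *)
Lemma smooth_support_parallel (D : pt -> Prop) (p u v : pt) :
  smooth_boundary D -> D p -> u <> (0, 0) ->
  (forall q, D q -> 0 <= cross u (psub q p)) ->
  (forall q, D q -> 0 <= cross v (psub q p)) -> cross u v = 0.
Proof.
  intros [g [L [_ [S1 [S2 [_ [_ [Hreg Hb]]]]]]]] Hp Hu H1 H2.
  assert (Bp : pboundary D p).
  { split; trivial; intros Hi.
    destruct (interior_not_supported _ u _ Hi Hu) as [y [Dy Hy]].
    specialize (H1 _ Dy); lra. }
  destruct (proj1 (Hb p) Bp) as [t0 Et].
  assert (Dg : forall t, D (g t)).
  { intros t; apply (proj2 (Hb (g t))); now exists t. }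
  assert (E1 : ex_derive (fun t => fst (g t)) t0) by exact (S1 1%nat t0).
  assert (E2 : ex_derive (fun t => snd (g t)) t0) by exact (S2 1%nat t0).
  assert (Key : forall w, (forall q, D q -> 0 <= cross w (psub q p)) ->
    fst w * Derive (fun t => snd (g t)) t0 - snd w * Derive (fun t => fst (g t)) t0 = 0).
  { intros w Hw.
    set (f := fun t => fst w * snd (g t) - snd w * fst (g t)).
    assert (Ef : is_derive f t0
      (fst w * Derive (fun t => snd (g t)) t0 - snd w * Derive (fun t => fst (g t)) t0)).
    { unfold f. apply @is_derive_minus; apply is_derive_scal; apply Derive_correct; assumption. }
    rewrite <- (is_derive_unique _ _ _ Ef).
    apply derive_at_min; [eexists; exact Ef|].
    intros s; specialize (Hw _ (Dg s)); unfold f; rewrite Et; pt_simpl; lra. }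
  pose proof (Key u H1) as K1; pose proof (Key v H2) as K2.
  specialize (Hreg t0).
  set (a := Derive (fun t => fst (g t)) t0) in *.
  set (b := Derive (fun t => snd (g t)) t0) in *.
  unfold cross.
  assert (a * (fst u * snd v - snd u * fst v) = 0).
  { replace (_ * _) with
      (fst v * (fst u * b - snd u * a) - fst u * (fst v * b - snd v * a)) by ring.
    rewrite K1, K2; ring. }
  assert (b * (fst u * snd v - snd u * fst v) = 0).
  { replace (_ * _) with
      (snd v * (fst u * b - snd u * a) - snd u * (fst v * b - snd v * a)) by ring.
    rewrite K1, K2; ring. }
  destruct Hreg as [Ha|Ha]; [apply (Rmult_eq_reg_l a)|apply (Rmult_eq_reg_l b)]; lra.
Qed.

(** * Sliding a triangle along one side *)

(** Cutting the interval into [n] equal steps bounds the total change by [C * (y - x) ^ 2 / n]. No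
    differentiability of [f] is assumed. *)
Lemma quadratic_const (f : R -> R) (a b C : R) :
  (forall x y, a < x < b -> a < y < b -> Rabs (f y - f x) <= C * (y - x) ^ 2) ->
  forall x y, a < x < b -> a < y < b -> f x = f y.
Proof.
  intros H x y Hx Hy.
  assert (Step : forall n, (0 < n)%nat -> forall k, (k <= n)%nat ->
    Rabs (f (x + INR k * ((y - x) / INR n)) - f x) <= INR k * (C * ((y - x) / INR n) ^ 2)).
  { intros n Hn; assert (0 < INR n) by now apply lt_0_INR.
    assert (In : forall k, (k <= n)%nat -> a < x + INR k * ((y - x) / INR n) < b).
    { intros k Hk; apply le_INR in Hk; pose proof (pos_INR k).
      set (t := INR k / INR n).
      assert (Ht : 0 <= t <= 1).
      { unfold t; split; [apply Rdiv_le_0_compat; lra|].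
        apply Rmult_le_reg_r with (INR n); trivial; field_simplify; lra. }
      replace (x + INR k * ((y - x) / INR n)) with ((1 - t) * x + t * y)
        by (unfold t; field; lra).
      destruct (Rle_dec x y); split; nra. }
    induction k as [|k IH]; intros Hk.
    - simpl INR; replace (_ - _) with 0 by (rewrite Rmult_0_l, Rplus_0_r; ring).
      rewrite Rabs_R0; lra.
    - specialize (IH ltac:(lia)).
      pose proof (H _ _ (In k ltac:(lia)) (In (S k) Hk)) as HH.
      rewrite S_INR in *; set (h := (y - x) / INR n) in *.
      replace ((x + (INR k + 1) * h) - (x + INR k * h)) with h in HH by ring.
      replace (f (x + (INR k + 1) * h) - f x) with
        ((f (x + (INR k + 1) * h) - f (x + INR k * h)) + (f (x + INR k * h) - f x)) by ring.
      eapply Rle_trans; [apply Rabs_triang|]; lra. }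
  apply NNPP; intros Hne.
  assert (P : 0 < Rabs (f y - f x)) by (apply Rabs_pos_lt; lra).
  set (e := Rabs (f y - f x)) in *.
  assert (Q : forall n, (0 < n)%nat -> INR n * e <= C * (y - x) ^ 2).
  { intros n Hn; pose proof (Step n Hn n (le_n n)) as S.
    assert (0 < INR n) by now apply lt_0_INR.
    replace (x + INR n * ((y - x) / INR n)) with y in S by (field; lra).
    fold e in S.
    replace (C * (y - x) ^ 2) with (INR n * (INR n * (C * ((y - x) / INR n) ^ 2))) by (field; lra).
    apply Rmult_le_compat_l; lra. }
  destruct (INR_unbounded (C * (y - x) ^ 2 / e)) as [N HN].
  specialize (Q (S N) ltac:(lia)); rewrite S_INR in Q.
  apply (Rmult_lt_compat_r e) in HN; trivial.
  replace (C * (y - x) ^ 2 / e * e) with (C * (y - x) ^ 2) in HN by (field; lra).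
  lra.
Qed.

(* The last two hypotheses are the support inequalities of two convex sets along a
   family of triangles with vertices (-m, 0), (m, 0) and (X m, H m). *)
Lemma sliding_triangle (X H : R -> R) (a b M : R) :
  0 < a -> (forall m, a < m < b -> Rabs (H m) <= M) ->
  (forall m n, a < m < b -> a < n < b ->
     0 <= (X m + m) * H n - H m * (X n - n + 2 * m)) ->
  (forall m n, a < m < b -> a < n < b ->
     0 <= (m - X m) * H n + H m * (X n + n - 2 * m)) ->
  forall m n, a < m < b -> a < n < b ->
    m * H m = n * H n /\ (H m <> 0 -> m * X m = n * X n).
Proof.
  intros Ha HM I1 I2.
  (* The sum of the two inequalities is twice this one; [X] cancels. *)
  assert (I3 : forall m n, a < m < b -> a < n < b -> 0 <= m * (H n - H m) + H m * (n - m)).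
  { intros m n Hm Hn; pose proof (I1 m n Hm Hn); pose proof (I2 m n Hm Hn); lra. }
  assert (Lip : forall m n, a < m < b -> a < n < b -> m < n ->
     Rabs (H n - H m) <= M / a * (n - m)).
  { intros m n Hm Hn Hmn.
    pose proof (I3 m n Hm Hn) as J1; pose proof (I3 n m Hn Hm) as J2.
    pose proof (HM m Hm) as B1; pose proof (HM n Hn) as B2.
    apply Rabs_le_between in B1; apply Rabs_le_between in B2.
    assert (0 <= M) by lra.
    assert (E : a * (M / a * (n - m)) = M * (n - m)) by (field; lra).
    assert (0 <= M / a) by (apply Rdiv_le_0_compat; lra).
    assert (0 <= M / a * (n - m)) by nra.
    assert (F1 : - (M * (n - m)) <= m * (H n - H m)) by nra.
    assert (F2 : n * (H n - H m) <= M * (n - m)) by nra.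
    apply Rabs_le; split; apply Rnot_lt_le; intros G; nra. }
  (* The product [m * H m] is the area. By [I3] in both orders its change is quadratic up to
     [(n - m) * (H n - H m)], which is quadratic by [Lip]. *)
  assert (C1 : forall m n, a < m < b -> a < n < b -> m * H m = n * H n).
  { apply (quadratic_const (fun m => m * H m) a b (M / a)).
    assert (W : forall m n, a < m < b -> a < n < b -> m < n ->
      Rabs (n * H n - m * H m) <= M / a * (n - m) ^ 2).
    { intros m n Hm Hn Hmn.
      pose proof (I3 m n Hm Hn) as J1; pose proof (I3 n m Hn Hm) as J2.
      pose proof (Lip m n Hm Hn Hmn) as J3; apply Rabs_le_between in J3.
      apply Rabs_le; split; nra. }
    intros m n Hm Hn; destruct (Rtotal_order m n) as [L|[E|L]].
    - now apply W.
    - subst n; replace (_ - _) with 0 by ring; rewrite Rabs_R0; lra.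
    - rewrite Rabs_minus_sym; replace ((n - m) ^ 2) with ((m - n) ^ 2) by ring; now apply W. }
  intros m n Hm Hn; split; [now apply C1|].
  intros Hne.
  set (c := m * H m).
  assert (Hc : c <> 0) by (apply Rmult_integral_contrapositive_currified; lra).
  assert (EH : forall k, a < k < b -> H k = c / k).
  { intros k Hk; unfold c; rewrite (C1 m k Hm Hk); field; lra. }
  apply (quadratic_const (fun m => m * X m) a b 1); trivial.
  intros x y Hx Hy.
  pose proof (I1 x y Hx Hy) as J1; pose proof (I2 x y Hx Hy) as J2.
  rewrite (EH x Hx), (EH y Hy) in J1, J2.
  assert (0 < x * y) by nra.
  apply (Rmult_le_compat_l (x * y)) in J1; [|lra].
  apply (Rmult_le_compat_l (x * y)) in J2; [|lra].
  (* With [H] equal to [c / m], the two inequalities bound the change of [m * X m] from either side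
     by [(y - x) ^ 2]. *)
  replace (x * y * ((X x + x) * (c / y) - c / x * (X y - y + 2 * x)))
    with (c * (x * X x - y * X y + (y - x) ^ 2)) in J1 by (field; lra).
  replace (x * y * ((x - X x) * (c / y) + c / x * (X y + y - 2 * x)))
    with (c * (y * X y - x * X x + (y - x) ^ 2)) in J2 by (field; lra).
  rewrite Rmult_0_r in J1, J2.
  assert (0 <= (y - x) ^ 2) by apply pow2_ge_0.
  destruct (Rdichotomy _ _ Hc).
  - apply Rabs_le; split; nra.
  - apply Rabs_le; split; nra.
Qed.

Definition refl (p x : pt) : pt := padd p (psub p x).

(** A closed orbit is recorded by its contact points, the midpoints of the sides; the last equation
    closes it up. *)
Definition billiard_triangle (D1 D2 D3 : pt -> Prop) (z p1 p2 p3 : pt) : Prop :=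
  support_point D1 z p1 /\ support_point D2 (refl p1 z) p2 /\
  support_point D3 (refl p2 (refl p1 z)) p3 /\ refl p3 (refl p2 (refl p1 z)) = z.

Lemma support_point_slide (D : pt -> Prop) (z p : pt) (m : R) :
  0 < m -> support_point D z p -> ~ D (padd p (pscal m (psub z p))) ->
  support_point D (padd p (pscal m (psub z p))) p.
Proof.
  intros Hm [_ [Hp Hs]] Hz; repeat split; trivial.
  intros q Hq; specialize (Hs q Hq).
  apply (Rmult_le_compat_l m) in Hs; [|lra]; pt_simpl; lra.
Qed.

Lemma segment_near (z p : pt) (e : R) :
  0 < e -> exists d, 0 < d < 1 /\
    forall m, 1 - d < m < 1 + d -> near e z (padd p (pscal m (psub z p))).
Proof.
  intros He; destruct z as [z1 z2], p as [p1 p2].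
  pose proof (Rabs_pos (z1 - p1)) as A1; pose proof (Rabs_pos (z2 - p2)) as A2.
  set (M := Rabs (z1 - p1) + Rabs (z2 - p2) + 1).
  assert (HM : 0 < M) by (unfold M; lra).
  exists (Rmin (1 / 2) (e / M)).
  pose proof (Rmin_l (1 / 2) (e / M)); pose proof (Rmin_r (1 / 2) (e / M)).
  assert (0 < e / M) by (apply Rdiv_lt_0_compat; lra).
  assert (0 < Rmin (1 / 2) (e / M)) by (apply Rmin_pos; lra).
  split; [lra|]; intros m Hm.
  assert (Hm' : Rabs (m - 1) < e / M) by (apply Rabs_def1; lra).
  assert (EM : e / M * M = e) by (field; lra).
  pose proof (Rabs_pos (m - 1)).
  unfold near; pt_simpl; split.
  - replace (_ - _) with ((m - 1) * (z1 - p1)) by ring. rewrite Rabs_mult; unfold M in *; nra.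
  - replace (_ - _) with ((m - 1) * (z2 - p2)) by ring. rewrite Rabs_mult; unfold M in *; nra.
Qed.

(* As z slides along its support line to D1, the contact point p1 stays fixed
   and p2 runs along a hyperbola centred at p1. *)
Lemma sliding_hyperbola (D1 D2 D3 U : pt -> Prop) (z0 p1 q2 q3 : pt) :
  strictly_convex D1 -> strictly_convex D2 -> strictly_convex D3 -> is_bounded D2 ->
  (forall z, U z -> exists e, 0 < e /\ forall y, near e z y -> U y) ->
  (forall z, U z -> exists p1 p2 p3, billiard_triangle D1 D2 D3 z p1 p2 p3) ->
  U z0 -> billiard_triangle D1 D2 D3 z0 p1 q2 q3 ->
  exists v d, 0 < d < 1 /\ cross (psub z0 p1) v <> 0 /\
    forall m, 1 - d < m < 1 + d ->
      let z := padd p1 (pscal m (psub z0 p1)) in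
      let p2 := padd p1 (pscal (1 / 2) (psub (pscal (/ m) v) (pscal m (psub z0 p1)))) in
      U z /\ exists p3, billiard_triangle D1 D2 D3 z p1 p2 p3.
Proof.
  intros SC1 SC2 SC3 HB HU HT Uz0 T0.
  destruct (HU _ Uz0) as [e [He Ue]].
  destruct (segment_near z0 p1 e He) as [d [Hd Hn]].
  set (Z := fun m => padd p1 (pscal m (psub z0 p1))) in *.
  (* Choice turns [p2] and [p3] into functions of [m]; the value [(z0, z0)] outside the interval is
     arbitrary. The first contact point remains [p1]. *)
  assert (Ex : forall m, exists P : pt * pt, 1 - d < m < 1 + d ->
    billiard_triangle D1 D2 D3 (Z m) p1 (fst P) (snd P)).
  { intros m; destruct (classic (1 - d < m < 1 + d)) as [Hm|Hm];
      [|now exists (z0, z0)].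
    destruct (HT _ (Ue _ (Hn m Hm))) as [r1 [r2 [r3 T]]].
    exists (r2, r3); intros _; simpl.
    assert (E : r1 = p1); [|rewrite E in T; exact T].
    apply (support_point_unique D1 (Z m)); trivial; [apply T|].
    apply support_point_slide; [lra|apply T0|apply T]. }
  apply functional_choice in Ex as [P HP].
  assert (Hw0 : psub z0 p1 <> (0, 0)).
  { apply psub_neq0; intros E; apply (proj1 (proj1 T0)); rewrite E; apply (proj1 T0). }
  assert (UZ : forall m, 1 - d < m < 1 + d -> U (Z m)) by (intros m Hm; exact (Ue _ (Hn m Hm))).
  clear Ue Hn.
  destruct z0 as [z1 z2], p1 as [a1 a2].
  set (w1 := z1 - a1); set (w2 := z2 - a2).
  assert (Hw : (w1, w2) <> (0, 0)) by exact Hw0.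
  pose proof (pos_norm2 _ _ Hw) as HN; set (N := w1 * w1 + w2 * w2) in *.
  set (S := fun m => fst (fst (P m)) - a1); set (T := fun m => snd (fst (P m)) - a2).
  (* Coordinates of the third vertex in the frame with origin [p1] and axes [w] and its quarter
     turn. The other two vertices are [(m, 0)] and [(- m, 0)]. *)
  set (X := fun m => 2 * (w1 * S m + w2 * T m) / N + m).
  set (H := fun m => 2 * (w1 * T m - w2 * S m) / N).
  assert (ES : forall m, S m = ((X m - m) * w1 - H m * w2) / 2).
  { intros m; unfold X, H; unfold N in *; field; lra. }
  assert (ET : forall m, T m = ((X m - m) * w2 + H m * w1) / 2).
  { intros m; unfold X, H; unfold N in *; field; lra. }
  assert (EP2 : forall m, fst (P m) = (a1 + S m, a2 + T m)).
  { intros m; unfold S, T; destruct (P m) as [[x y] ?]; simpl; f_equal; ring. }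
  assert (EP3 : forall m, 1 - d < m < 1 + d ->
    snd (P m) = (a1 + S m + m * w1, a2 + T m + m * w2)).
  { intros m Hm; destruct (HP m Hm) as [_ [_ [_ E]]]; rewrite EP2 in E.
    destruct (snd (P m)) as [x y]; unfold refl, Z in E; pt_simpl; fold w1 w2 in E.
    injection E; intros; f_equal; lra. }
  (* Support inequality of [D2] at position [m], tested on the contact point at position [n];
     [N / 4] is the factor from the change of frame. [I2] is the same for [D3]. *)
  assert (I1 : forall m n, 1 - d < m < 1 + d -> 1 - d < n < 1 + d ->
     0 <= (X m + m) * H n - H m * (X n - n + 2 * m)).
  { intros m n Hm Hn.
    destruct (HP m Hm) as [_ [[_ [_ K]] _]]; destruct (HP n Hn) as [_ [[_ [Dn _]] _]].
    specialize (K _ Dn); rewrite !EP2 in K; unfold refl, Z in K; pt_simpl; fold w1 w2 in K.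
    rewrite !ES, !ET in K.
    apply Rmult_le_reg_l with (N / 4); [lra|]; rewrite Rmult_0_r.
    eapply Rle_trans; [exact K|]; right; unfold N; field. }
  assert (I2 : forall m n, 1 - d < m < 1 + d -> 1 - d < n < 1 + d ->
     0 <= (m - X m) * H n + H m * (X n + n - 2 * m)).
  { intros m n Hm Hn.
    destruct (HP m Hm) as [_ [_ [[_ [_ K]] _]]]; destruct (HP n Hn) as [_ [_ [[_ [Dn _]] _]]].
    specialize (K _ Dn); rewrite EP2, !EP3 in K by trivial.
    unfold refl, Z in K; pt_simpl; fold w1 w2 in K.
    rewrite !ES, !ET in K.
    apply Rmult_le_reg_l with (N / 4); [lra|]; rewrite Rmult_0_r.
    eapply Rle_trans; [exact K|]; right; unfold N; field. }
  destruct (bounded_coord D2 HB) as [M [HM Hbd]].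
  assert (HH : forall m, 1 - d < m < 1 + d ->
    Rabs (H m) <= 2 * (Rabs w1 * (M + Rabs a2) + Rabs w2 * (M + Rabs a1)) / N).
  { intros m Hm; destruct (HP m Hm) as [_ [[_ [Dm _]] _]].
    destruct (Hbd _ Dm) as [B1 B2].
    assert (C1 : Rabs (S m) <= M + Rabs a1).
    { unfold S, Rminus; eapply Rle_trans; [apply Rabs_triang|]; rewrite Rabs_Ropp; lra. }
    assert (C2 : Rabs (T m) <= M + Rabs a2).
    { unfold T, Rminus; eapply Rle_trans; [apply Rabs_triang|]; rewrite Rabs_Ropp; lra. }
    unfold H, Rdiv; rewrite Rabs_mult, (Rabs_pos_eq (/ N)) by (left; now apply Rinv_0_lt_compat).
    apply Rmult_le_compat_r; [left; now apply Rinv_0_lt_compat|].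
    rewrite Rabs_mult, (Rabs_pos_eq 2) by lra; apply Rmult_le_compat_l; [lra|].
    unfold Rminus; eapply Rle_trans; [apply Rabs_triang|]; rewrite Rabs_Ropp, !Rabs_mult.
    pose proof (Rabs_pos w1); pose proof (Rabs_pos w2).
    apply Rplus_le_compat; apply Rmult_le_compat_l; lra. }
  pose proof (sliding_triangle X H (1 - d) (1 + d) _ ltac:(lra) HH I1 I2) as Sl.
  assert (J1 : 1 - d < 1 < 1 + d) by lra.
  assert (H1 : H 1 <> 0).
  { (* otherwise the line of z0 and p1 touches D2 and D3 at points independent of z *)
    intros H1.
    set (k := 1 + d / 2); assert (Jk : 1 - d < k < 1 + d) by (unfold k; lra).
    assert (Hk : H k = 0).
    { destruct (Sl 1 k J1 Jk) as [E _]; rewrite H1 in E.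
      apply Rmult_eq_reg_l with k; lra. }
    destruct (HP 1 J1) as [_ [T2 [T3 _]]]; destruct (HP k Jk) as [_ [T2' [T3' _]]].
    assert (E2 : fst (P 1) = fst (P k)).
    { apply (support_line_unique D2 (psub (fst (P 1)) (refl (a1, a2) (Z 1))) (refl (a1, a2) (Z 1)));
        try solve [trivial | apply T2 | apply T2'].
      - apply (support_point_dir D2), T2.
      - unfold cross; ring.
      - rewrite !EP2; unfold refl, Z; pt_simpl; fold w1 w2.
        rewrite !ES, !ET, H1, Hk; field. }
    assert (E3 : snd (P 1) = snd (P k)).
    { set (y2 := refl (fst (P 1)) (refl (a1, a2) (Z 1))) in *.
      apply (support_line_unique D3 (psub (snd (P 1)) y2) y2);
        try solve [trivial | apply T3 | apply T3'].
      - apply (support_point_dir D3), T3.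
      - unfold cross; ring.
      - unfold y2; rewrite !EP2, !EP3 by trivial; unfold refl, Z; pt_simpl; fold w1 w2.
        rewrite !ES, !ET, H1, Hk; field. }
    rewrite !EP2 in E2; rewrite !EP3 in E3 by trivial.
    injection E2; injection E3; intros.
    assert ((k - 1) * w1 = 0) by lra; assert ((k - 1) * w2 = 0) by lra.
    assert (k - 1 <> 0) by (unfold k; lra).
    apply Hw; f_equal; apply Rmult_eq_reg_l with (k - 1); lra. }
  (* Here [v] is the third vertex relative to [p1] at [m = 1]; at [m] it is [v / m], and [p2] is its
     midpoint with [- m w]. *)
  exists (X 1 * w1 - H 1 * w2, X 1 * w2 + H 1 * w1), d; split; [exact Hd|split].
  - pt_simpl; fold w1 w2.
    replace (_ - _) with (H 1 * N) by (unfold N; ring).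
    apply Rmult_integral_contrapositive_currified; lra.
  - intros m Hm; split; [exact (UZ m Hm)|]; exists (snd (P m)).
    pose proof (HP m Hm) as Tm.
    destruct (Sl 1 m J1 Hm) as [EH EX]; specialize (EX H1).
    assert (EH' : H m = H 1 / m) by (replace (H 1) with (m * H m) by lra; field; lra).
    assert (EX' : X m = X 1 / m) by (replace (X 1) with (m * X m) by lra; field; lra).
    rewrite EP2, ES, ET, EH', EX' in Tm.
    match type of Tm with billiard_triangle _ _ _ _ _ ?p _ =>
      match goal with |- billiard_triangle _ _ _ _ _ ?q _ => replace q with p end end;
      [exact Tm|].
    pt_simpl; fold w1 w2; f_equal; field; lra.
Qed.

(** * Hyperbolas sharing an arc *)

Lemma quartic_zero (b0 b1 b2 b3 b4 d : R) :
  0 < d ->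
  (forall m, 1 - d < m < 1 + d -> b0 + b1 * m + b2 * m ^ 2 + b3 * m ^ 3 + b4 * m ^ 4 = 0) ->
  b0 = 0 /\ b1 = 0 /\ b2 = 0 /\ b3 = 0 /\ b4 = 0.
Proof.
  intros Hd H; set (h := d / 4).
  assert (Hh : 0 < h) by (unfold h; lra).
  pose proof (H 1 ltac:(lra)) as E0.
  pose proof (H (1 + h) ltac:(unfold h; lra)) as E1.
  pose proof (H (1 - h) ltac:(unfold h; lra)) as E2.
  pose proof (H (1 + 2 * h) ltac:(unfold h; lra)) as E3.
  pose proof (H (1 - 2 * h) ltac:(unfold h; lra)) as E4.
  (* These and [b4] are the Taylor coefficients at 1. Values at [1 + h] and [1 - h], and likewise
     with [2 * h], separate the odd and even ones. *)
  set (c1 := b1 + 2 * b2 + 3 * b3 + 4 * b4).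
  set (c2 := b2 + 3 * b3 + 6 * b4).
  set (c3 := b3 + 4 * b4).
  assert (F1 : c1 * h + c3 * h ^ 3 = 0) by (unfold c1, c3; lra).
  assert (F2 : c2 * h ^ 2 + b4 * h ^ 4 = 0) by (unfold c2; lra).
  assert (F3 : 2 * c1 * h + 8 * c3 * h ^ 3 = 0) by (unfold c1, c3; lra).
  assert (F4 : 4 * c2 * h ^ 2 + 16 * b4 * h ^ 4 = 0) by (unfold c2; lra).
  assert (P2 : 0 < h ^ 2) by now apply pow_lt.
  assert (P3 : 0 < h ^ 3) by now apply pow_lt.
  assert (P4 : 0 < h ^ 4) by now apply pow_lt.
  assert (G4 : b4 = 0) by (apply Rmult_eq_reg_r with (h ^ 4); lra).
  assert (G3 : c3 = 0) by (apply Rmult_eq_reg_r with (h ^ 3); lra).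
  assert (G2 : c2 = 0) by (rewrite G4 in F2; apply Rmult_eq_reg_r with (h ^ 2); lra).
  assert (G1 : c1 = 0) by (rewrite G3 in F1; apply Rmult_eq_reg_r with h; lra).
  unfold c1, c2, c3 in *; repeat split; lra.
Qed.

(* The hyperbola through the points c + (v'/m - m w')/2 has centre c, and the
   one given by cross (s, w) cross (s, v) = K has centre 0. *)
Lemma hyperbola_center_unique (w v w' v' c : pt) (K d : R) :
  0 < d < 1 -> cross w v <> 0 -> cross w' v' <> 0 ->
  (forall m, 1 - d < m < 1 + d ->
     let s := padd c (pscal (1 / 2) (psub (pscal (/ m) v') (pscal m w'))) in
     cross s w * cross s v = K) ->
  c = (0, 0).
Proof.
  intros Hd Hwv Hwv' Hs.
  (* On the arc, [cross s w] is [A0 + A1 / m + A2 * m], and [cross s v] is the same with [B]. *)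
  set (A0 := cross c w); set (A1 := cross v' w / 2); set (A2 := - cross w' w / 2).
  set (B0 := cross c v); set (B1 := cross v' v / 2); set (B2 := - cross w' v / 2).
  assert (Plu : A1 * B2 - A2 * B1 <> 0).
  { replace (A1 * B2 - A2 * B1) with (cross w v * cross w' v' / 4)
      by (unfold A1, A2, B1, B2, cross; field).
    assert (cross w v * cross w' v' <> 0)
      by now apply Rmult_integral_contrapositive_currified.
    lra. }
  (* Multiplying the equation of the hyperbola by [m ^ 2] gives a quartic in [m]. *)
  destruct (quartic_zero (A1 * B1) (A0 * B1 + A1 * B0)
              (A0 * B0 + A1 * B2 + A2 * B1 - K) (A0 * B2 + A2 * B0) (A2 * B2) d
              ltac:(lra)) as [Q0 [Q1 [_ [Q3 Q4]]]].
  { intros m Hm; specialize (Hs m Hm); simpl in Hs; rewrite <- Hs.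
    unfold A0, A1, A2, B0, B1, B2; pt_simpl; field; lra. }
  (* One of [A2], [B2] vanishes; the determinant [Plu] then makes the opposite pair nonzero, and the
     other coefficients force [A0] and [B0] to vanish. *)
  assert (Z : A0 = 0 /\ B0 = 0).
  { apply Rmult_integral in Q4 as [E|E]; rewrite E in Plu, Q3.
    - assert (A1 <> 0) by (intros G; rewrite G in Plu; lra).
      assert (B2 <> 0) by (intros G; rewrite G in Plu; lra).
      assert (A0 = 0) by (apply Rmult_eq_reg_r with B2; lra).
      assert (B1 = 0) by (apply Rmult_eq_reg_l with A1; lra).
      split; trivial; apply Rmult_eq_reg_l with A1; nra.
    - assert (B1 <> 0) by (intros G; rewrite G in Plu; lra).
      assert (A2 <> 0) by (intros G; rewrite G in Plu; lra).
      assert (B0 = 0) by (apply Rmult_eq_reg_l with A2; lra).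
      assert (A1 = 0) by (apply Rmult_eq_reg_r with B1; lra).
      split; trivial; apply Rmult_eq_reg_r with B1; nra. }
  destruct Z as [Z1 Z2]; unfold A0, B0 in *.
  destruct c as [c1 c2], w as [w1 w2], v as [v1 v2]; pt_simpl.
  f_equal; apply Rmult_eq_reg_l with (w1 * v2 - w2 * v1); trivial.
  - replace (_ * _) with (w1 * (c1 * v2 - c2 * v1) - v1 * (c1 * w2 - c2 * w1)) by ring.
    rewrite Z1, Z2; ring.
  - replace (_ * _) with (w2 * (c1 * v2 - c2 * v1) - v2 * (c1 * w2 - c2 * w1)) by ring.
    rewrite Z1, Z2; ring.
Qed.

(** * Contact points for positions off the line *)

(** The line from [p1 - w] to [p2] is transversal to the line through [p1] along [w], so a perturbed
    line still crosses it near [p1 - w]. The bound [t < 1] puts the crossing before [q], which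
    preserves the orientation of the support line. *)
Lemma nearby_line_crosses (p1 w p2 : pt) (d : R) :
  0 < d -> cross w (psub p2 p1) <> 0 ->
  exists h, 0 < h /\ forall a q, near h (psub p1 w) a -> near h p2 q ->
    exists m t, 1 - d < m < 1 + d /\ t < 1 /\
      psub p1 (pscal m w) = padd a (pscal t (psub q a)).
Proof.
  intros Hd Hc; destruct p1 as [x y], w as [w1 w2], p2 as [u v].
  assert (Hw : (w1, w2) <> (0, 0)).
  { intros E; apply Hc; rewrite E; unfold cross; simpl; ring. }
  pose proof (pos_norm1 _ _ Hw) as HW.
  pt_simpl.
  pose proof (Rabs_pos_lt _ Hc) as HK.
  set (c := w1 * (v - y) - w2 * (u - x)) in *; set (K := Rabs c) in *.
  set (W := Rabs w1 + Rabs w2) in *.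
  set (L1 := Rabs (u - (x - w1))); set (L2 := Rabs (v - (y - w2))).
  pose proof (Rabs_pos (u - (x - w1))) as HL1; fold L1 in HL1.
  pose proof (Rabs_pos (v - (y - w2))) as HL2; fold L2 in HL2.
  set (k := 2 * W / K).
  assert (Hk : 0 < k) by (apply Rdiv_lt_0_compat; lra).
  set (B := 2 + k * (L1 + L2 + 4)).
  assert (HB : 0 < B) by (unfold B; nra).
  (* The bound [K / (4 * W)] keeps the determinant [M] at least [K / 2] in size; the last bound
     yields [Rabs (m - 1) <= d / 2]. *)
  set (h := Rmin (Rmin 1 (K / (4 * W))) (d * W / (2 * B))).
  assert (E1 : 0 < K / (4 * W)) by (apply Rdiv_lt_0_compat; lra).
  assert (E2 : 0 < d * W / (2 * B)) by (apply Rdiv_lt_0_compat; nra).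
  assert (Hh : 0 < h) by (unfold h; repeat apply Rmin_pos; lra).
  assert (h <= 1 /\ h <= K / (4 * W) /\ h <= d * W / (2 * B)) as [G1 [G2 G3]].
  { unfold h; pose proof (Rmin_l (Rmin 1 (K / (4 * W))) (d * W / (2 * B))).
    pose proof (Rmin_r (Rmin 1 (K / (4 * W))) (d * W / (2 * B))).
    pose proof (Rmin_l 1 (K / (4 * W))); pose proof (Rmin_r 1 (K / (4 * W))); lra. }
  assert (G2' : W * h <= K / 4).
  { apply (Rmult_le_compat_l W) in G2; [|lra].
    replace (W * (K / (4 * W))) with (K / 4) in G2 by (field; lra); lra. }
  assert (G3' : B * h <= d * W / 2).
  { apply (Rmult_le_compat_l B) in G3; [|lra].
    replace (B * (d * W / (2 * B))) with (d * W / 2) in G3 by (field; lra); lra. }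
  exists h; split; trivial.
  intros [a1 a2] [q1 q2] [A1 A2] [Q1 Q2]; simpl in *.
  set (M := w1 * (q2 - a2) - w2 * (q1 - a1)).
  set (n := w1 * (y - a2) - w2 * (x - a1)).
  assert (Cr : forall r s f, Rabs r <= f -> Rabs s <= f -> Rabs (w1 * s - w2 * r) <= W * f).
  { intros r s f Hr Hs; unfold Rminus; eapply Rle_trans; [apply Rabs_triang|].
    rewrite Rabs_Ropp, !Rabs_mult; pose proof (Rabs_pos w1); pose proof (Rabs_pos w2).
    unfold W; nra. }
  assert (Hn : Rabs n <= W * h).
  { unfold n; replace (_ - _) with (w1 * - (a2 - (y - w2)) - w2 * - (a1 - (x - w1))) by ring.
    apply Cr; rewrite Rabs_Ropp; lra. }
  assert (HM : Rabs (M - c) <= W * (2 * h)).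
  { unfold M, c.
    replace (_ - _) with (w1 * ((q2 - v) + - (a2 - (y - w2))) - w2 * ((q1 - u) + - (a1 - (x - w1)))) by ring.
    apply Cr; (eapply Rle_trans; [apply Rabs_triang|]); rewrite Rabs_Ropp; lra. }
  assert (HM2 : K / 2 <= Rabs M).
  { unfold K in *; pose proof (Rabs_triang_inv c (c - M)) as T.
    replace (c - (c - M)) with M in T by ring. rewrite (Rabs_minus_sym c M) in T; lra. }
  assert (M0 : M <> 0) by (intros E; rewrite E, Rabs_R0 in HM2; lra).
  (* Cramer's rule for the crossing point gives [t] here and [m] below. *)
  set (t := n / M).
  assert (Ht : Rabs t <= k * h).
  { unfold t, Rdiv; rewrite Rabs_mult, Rabs_inv.
    apply Rmult_le_reg_r with (Rabs M); [lra|].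
    rewrite Rmult_assoc, Rinv_l, Rmult_1_r by lra.
    apply Rle_trans with (k * h * (K / 2)).
    - replace (k * h * (K / 2)) with (W * h) by (unfold k; field; lra); lra.
    - apply Rmult_le_compat_l; nra. }
  assert (Hkh : k * h <= 1 / 2).
  { unfold k; replace (2 * W / K * h) with (2 * (W * h) / K) by (field; lra).
    apply Rmult_le_reg_r with K; trivial.
    replace (2 * (W * h) / K * K) with (2 * (W * h)) by (field; lra). lra. }
  set (m := ((q1 - a1) * (y - a2) - (q2 - a2) * (x - a1)) / - M).
  assert (Em1 : (m - 1) * w1 = - (a1 - (x - w1)) + - t * (q1 - a1)).
  { unfold m, t, n; unfold M in *; field; trivial. }
  assert (Em2 : (m - 1) * w2 = - (a2 - (y - w2)) + - t * (q2 - a2)).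
  { unfold m, t, n; unfold M in *; field; trivial. }
  assert (F1 : Rabs (q1 - a1) <= L1 + 2 * h).
  { replace (q1 - a1) with ((q1 - u) + ((u - (x - w1)) + - (a1 - (x - w1)))) by ring.
    eapply Rle_trans; [apply Rabs_triang|].
    pose proof (Rabs_triang (u - (x - w1)) (- (a1 - (x - w1)))) as T; rewrite Rabs_Ropp in T.
    fold L1 in T; lra. }
  assert (F2 : Rabs (q2 - a2) <= L2 + 2 * h).
  { replace (q2 - a2) with ((q2 - v) + ((v - (y - w2)) + - (a2 - (y - w2)))) by ring.
    eapply Rle_trans; [apply Rabs_triang|].
    pose proof (Rabs_triang (v - (y - w2)) (- (a2 - (y - w2)))) as T; rewrite Rabs_Ropp in T.
    fold L2 in T; lra. }
  assert (P1 : Rabs t * Rabs (q1 - a1) <= k * h * (L1 + 2))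
    by (apply Rmult_le_compat; try apply Rabs_pos; lra).
  assert (P2 : Rabs t * Rabs (q2 - a2) <= k * h * (L2 + 2))
    by (apply Rmult_le_compat; try apply Rabs_pos; lra).
  assert (R1 : Rabs (m - 1) * Rabs w1 <= h + k * h * (L1 + 2)).
  { rewrite <- Rabs_mult, Em1; eapply Rle_trans; [apply Rabs_triang|].
    rewrite Rabs_mult, !Rabs_Ropp; lra. }
  assert (R2 : Rabs (m - 1) * Rabs w2 <= h + k * h * (L2 + 2)).
  { rewrite <- Rabs_mult, Em2; eapply Rle_trans; [apply Rabs_triang|].
    rewrite Rabs_mult, !Rabs_Ropp; lra. }
  assert (RR : Rabs (m - 1) * W <= d / 2 * W).
  { apply Rle_trans with (B * h); [unfold W, B; lra|lra]. }
  apply Rmult_le_reg_r in RR; trivial.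
  exists m, t; split; [apply Rabs_le_between in RR; lra|split].
  - pose proof (Rle_abs t); lra.
  - f_equal; lra.
Qed.

(** The support line of [D2] for [z] crosses the line of [z0] and [p1] at a second vertex of some
    slid triangle. From there it is still the right support line, so by uniqueness [q2] is the
    contact point of that triangle. *)
Lemma nearby_on_hyperbola (D1 D2 D3 U : pt -> Prop) (z0 p1 p2 p3 v : pt) (d : R) :
  is_compact D1 -> pconvex D1 -> strictly_convex D1 ->
  is_compact D2 -> pconvex D2 -> strictly_convex D2 ->
  billiard_triangle D1 D2 D3 z0 p1 p2 p3 ->
  0 < d < 1 -> cross (psub z0 p1) v <> 0 ->
  (forall m, 1 - d < m < 1 + d ->
      let z := padd p1 (pscal m (psub z0 p1)) in
      let p2 := padd p1 (pscal (1 / 2) (psub (pscal (/ m) v) (pscal m (psub z0 p1)))) in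
      U z /\ exists p3, billiard_triangle D1 D2 D3 z p1 p2 p3) ->
  exists r, 0 < r /\ forall z q1 q2 q3, near r z0 z ->
    billiard_triangle D1 D2 D3 z q1 q2 q3 ->
    cross (psub q2 p1) (psub z0 p1) * cross (psub q2 p1) v
      = (cross (psub z0 p1) v) ^ 2 / 4.
Proof.
  intros C1 V1 SC1 C2 V2 SC2 T Hd Hc Sl.
  assert (Er : forall m, refl p1 (padd p1 (pscal m (psub z0 p1))) = psub p1 (pscal m (psub z0 p1))).
  { intros m; unfold refl; destruct z0, p1; pt_simpl; f_equal; ring. }
  assert (Er0 : refl p1 z0 = psub p1 (psub z0 p1)).
  { unfold refl; destruct z0, p1; pt_simpl; f_equal; ring. }
  assert (E2 : p2 = padd p1 (pscal (1 / 2) (psub v (psub z0 p1)))).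
  { apply (support_point_unique D2 (refl p1 z0)); trivial; [apply T|].
    destruct (Sl 1 ltac:(lra)) as [_ [r3 [_ [T2 _]]]].
    replace (refl p1 z0) with (refl p1 (padd p1 (pscal 1 (psub z0 p1))))
      by (rewrite Er, Er0; destruct z0, p1; pt_simpl; f_equal; ring).
    replace (psub v (psub z0 p1)) with (psub (pscal (/ 1) v) (pscal 1 (psub z0 p1)))
      by (destruct z0, p1, v; pt_simpl; f_equal; field).
    exact T2. }
  assert (Hc2 : cross (psub z0 p1) (psub p2 p1) <> 0).
  { rewrite E2; replace (cross _ _) with (cross (psub z0 p1) v / 2)
      by (destruct z0, p1, v; pt_simpl; field).
    lra. }
  destruct (nearby_line_crosses p1 (psub z0 p1) p2 d (proj1 Hd) Hc2) as [h [Hh Hl]].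
  rewrite <- Er0 in Hl.
  destruct T as [T1 [T2 _]].
  destruct (support_point_continuous D2 _ _ C2 V2 SC2 T2 h Hh) as [e [He Hcont2]].
  (* Reflecting [z] in [q1] moves the image by at most twice the change of [q1] plus that of [z];
     [4 * f] covers this. *)
  set (f := Rmin h e / 4).
  assert (Hf : 0 < f) by (unfold f; pose proof (Rmin_pos h e Hh He); lra).
  assert (4 * f <= h /\ 4 * f <= e) as [F1 F2]
    by (unfold f; pose proof (Rmin_l h e); pose proof (Rmin_r h e); lra).
  destruct (support_point_continuous D1 _ _ C1 V1 SC1 T1 f Hf) as [g [Hg Hcont1]].
  exists (Rmin f g); split; [now apply Rmin_pos|].
  intros z q1 q2 q3 [Hz1 Hz2] [S1 [S2 _]].
  pose proof (Rmin_l f g); pose proof (Rmin_r f g).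
  destruct (Hcont1 z q1 ltac:(split; lra) S1) as [N1 N2].
  assert (Na : near (4 * f) (refl p1 z0) (refl q1 z)).
  { unfold near, refl; destruct z0, p1, z, q1; pt_simpl.
    repeat match goal with K : Rabs _ < _ |- _ => apply Rabs_def2 in K end.
    split; apply Rabs_def1; lra. }
  assert (Nq : near h p2 q2).
  { apply (Hcont2 (refl q1 z)); trivial; destruct Na; split; lra. }
  destruct (Hl (refl q1 z) q2) as [m [t [Hm [Ht Ey]]]]; trivial.
  { destruct Na; split; lra. }
  destruct (Sl m Hm) as [_ [r3 [_ [R2 _]]]].
  rewrite Er in R2.
  (* Seen from the crossing point, the vector to [q2] is scaled by [1 - t], which is positive. *)
  assert (Sq : support_point D2 (psub p1 (pscal m (psub z0 p1))) q2).
  { split; [apply R2|]; destruct S2 as [_ [Dq S2]]; split; trivial.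
    intros s Hs; specialize (S2 s Hs); rewrite Ey.
    apply (Rmult_le_compat_l (1 - t)) in S2; [|lra].
    destruct (refl q1 z), q2, s; pt_simpl; nra. }
  rewrite (support_point_unique _ _ _ _ SC2 Sq R2).
  destruct z0, p1, v; pt_simpl; field; lra.
Qed.

(** * Two sliding families with different centres *)

Theorem theorem5p3 (D1 D2 D3 : pt -> Prop) :
  outer_billiard_table D1 -> outer_billiard_table D2 -> outer_billiard_table D3 ->
  ~ (exists x : pt, pinterior
       (fun z : pt => exists y1 y2 : pt,
           outer_billiard D1 z y1 /\ outer_billiard D2 y1 y2 /\
           outer_billiard D3 y2 z) x).
Proof.
  intros [C1 [V1 [SC1 [_ Sm1]]]] [C2 [V2 [SC2 [_ _]]]] [_ [_ [SC3 _]]] [z0 Hi].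
  apply interior_near in Hi as [r [Hr Hi]].
  assert (HT : forall z, near r z0 z -> exists p1 p2 p3, billiard_triangle D1 D2 D3 z p1 p2 p3).
  { intros z Hz; destruct (Hi z Hz) as
      [y1 [y2 [[A1 [p1 [B1 [E1 F1]]]] [[A2 [p2 [B2 [E2 F2]]]] [A3 [p3 [B3 [E3 F3]]]]]]]].
    subst y1 y2; exists p1, p2, p3; unfold billiard_triangle, support_point, refl; auto 10. }
  assert (Self : forall e, 0 < e -> near e z0 z0)
    by (intros e He; unfold near; rewrite !Rminus_diag, Rabs_R0; split; trivial).
  destruct (HT z0 (Self r Hr)) as [p1 [p2 [p3 T]]].
  destruct (sliding_hyperbola D1 D2 D3 (near r z0) z0 p1 p2 p3)
    as [v [d [Hd [Hv Sl]]]]; trivial; [apply C2|intros z; apply near_open|now apply Self|].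
  destruct (nearby_on_hyperbola D1 D2 D3 (near r z0) z0 p1 p2 p3 v d)
    as [e [He Hyp]]; trivial.
  set (f := Rmin r e); assert (Hf : 0 < f) by now apply Rmin_pos.
  assert (Fr : forall z, near f z0 z -> near r z0 z /\ near e z0 z).
  { intros z [Z1 Z2]; pose proof (Rmin_l r e); pose proof (Rmin_r r e); unfold f in *.
    repeat split; lra. }
  assert (Hw : psub p1 z0 <> (0, 0)) by (apply (support_point_dir D1), T).
  assert (Ez : exists z, near f z0 z /\ cross (psub p1 z0) (psub p1 z) <> 0).
  { destruct z0 as [x y], p1 as [a b]; pt_simpl.
    pose proof (pos_norm1 _ _ Hw) as N1; pose proof (pos_norm2 _ _ Hw) as N2.
    pose proof (Rabs_pos (a - x)); pose proof (Rabs_pos (b - y)).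
    set (m := Rabs (a - x) + Rabs (b - y)) in *; set (s := f / (2 * m)).
    assert (Hs : 0 < s) by (apply Rdiv_lt_0_compat; lra).
    assert (Esm : s * m = f / 2) by (unfold s; field; lra).
    (* A step perpendicular to the support line, of size at most [f / 2] in each coordinate. *)
    exists (x + s * (b - y), y - s * (a - x)); unfold near; simpl; split; [split|].
    - replace (_ - _) with (s * (b - y)) by ring.
      rewrite Rabs_mult, (Rabs_pos_eq s) by lra; unfold m in *; nra.
    - replace (_ - _) with (s * - (a - x)) by ring.
      rewrite Rabs_mult, (Rabs_pos_eq s), Rabs_Ropp by lra; unfold m in *; nra.
    - replace (_ - _) with (s * ((a - x) * (a - x) + (b - y) * (b - y))) by ring.
      apply Rmult_integral_contrapositive_currified; lra. }
  destruct Ez as [z' [Nz Hcr]].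
  destruct (HT z' (proj1 (Fr z' Nz))) as [q1 [q2 [q3 T']]].
  (* Sliding inside [near f z0] keeps every position where [Hyp] applies, so the second arc lies on
     the first hyperbola. *)
  destruct (sliding_hyperbola D1 D2 D3 (near f z0) z' q1 q2 q3)
    as [v' [d' [Hd' [Hv' Sl']]]]; trivial;
    [apply C2|intros z; apply near_open|intros z Hz; apply HT, Fr, Hz|].
  assert (Eq : psub q1 p1 = (0, 0)).
  { apply (hyperbola_center_unique (psub z0 p1) v (psub z' q1) v' _
             (cross (psub z0 p1) v ^ 2 / 4) d'); trivial.
    intros m Hm; destruct (Sl' m Hm) as [Um [s3 Tm]].
    rewrite <- (Hyp _ _ _ _ (proj2 (Fr _ Um)) Tm).
    destruct z0, p1, z', q1, v, v'; pt_simpl; ring. }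
  assert (q1 = p1).
  { apply NNPP; intros Hn; exact (psub_neq0 _ _ Hn Eq). }
  (* Both [z0] and [z'] now have contact point [p1], so their support directions are parallel,
     against the choice of [z']. *)
  subst q1; apply Hcr.
  destruct T as [[_ [Dp Hp]] _], T' as [[_ [_ Hq]] _].
  apply (smooth_support_parallel D1 p1); trivial.
  - intros s Hs; specialize (Hp s Hs); pt_simpl; lra.
  - intros s Hs; specialize (Hq s Hs); pt_simpl; lra.
Qed.
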